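(* Let $U$ and $V$ be two triangulations of a convex polygon $\pi$, and let $(a,b)$ and $(c,d)$ be two clockwise oriented boundary edges on $\pi$. If the edges $\{a,\mathrm{lk}_U(\{a,b\})\}$ and $\{c,\mathrm{lk}_U(\{c,d\})\}$ are distinct, and if they respectively cross the edges $\{d,\mathrm{lk}_V(\{c,d\})\}$ and $\{b,\mathrm{lk}_V(\{a,b\})\}$, then $\vartheta(\{U,V\},a)$ and $\vartheta(\{U,V\},c)$ cannot both be less than $2$.
   Context: An edge on a convex polygon is a set of two of its vertices; two edges cross if they are disjoint but their convex hulls intersect. A triangulation is an inclusion-maximal set of pairwise non-crossing edges. A flip replaces an interior edge $\varepsilon$ of a triangulation $T$ by the other diagonal of the unique quadrilateral having $\varepsilon$ as a diagonal and its four sides in $T$. A path from $U$ to $V$ is a sequence of triangulations starting at $U$, ending at $V$, consecutive ones differing by a flip; it is geodesic if its length (number of flips) is minimal. A clockwise oriented boundary edge $(a,b)$ is a pair of vertices with $b$ immediately following $a$ clockwise. For a triangulation $T$, $\mathrm{lk}_T(\{a,b\})$ is the unique vertex $x$ with $\{a,x\},\{b,x\}\in T$. A flip from $T$ to $T'$ is incident to $\{a,b\}$ if $\mathrm{lk}_T(\{a,b\})\neq\mathrm{lk}_{T'}(\{a,b\})$. For a vertex $a$ with clockwise successor $b$, $\vartheta(\{U,V\},a)$ is the maximum, over all geodesic paths between $U$ and $V$, of the number of flips incident to $\{a,b\}$ along the path. *)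

(* Defs.v *)
From HB Require Import structures.
From mathcomp Require Import all_boot all_order all_algebra.
From mathcomp Require Import boolp classical_sets reals.

Set Implicit Arguments.
Unset Strict Implicit.
Unset Printing Implicit Defensive.

Import Order.TTheory GRing.Theory Num.Theory.
Local Open Scope ring_scope.

(* Twice the signed area of the triangle [u v w]; negative iff [u, v, w] is a
   clockwise turn (first axis to the right, second axis upwards). *)
Definition orient (R : realType) (u v w : 'rV[R]_2) : R :=
  (v 0 0 - u 0 0) * (w 0 1 - u 0 1) - (v 0 1 - u 0 1) * (w 0 0 - u 0 0).

(* [p 0, ..., p (n - 1)] are the vertices of a (strictly) convex polygon, listed
   clockwise.  Below, a vertex is designated by its index. *)
Definition convex_polygon (R : realType) (n : nat) (p : 'I_n -> 'rV[R]_2) :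
    Prop :=
  (2 < n)%N /\
  forall i j k : 'I_n, (i < j < k)%N -> orient (p i) (p j) (p k) < 0.

Definition is_edge (n : nat) (e : {set 'I_n}) : bool := (#|e| == 2)%N.

Definition in_conv_hull (R : realType) (n : nat) (p : 'I_n -> 'rV[R]_2)
    (e : {set 'I_n}) (x : 'rV[R]_2) : Prop :=
  exists w : 'I_n -> R,
    [/\ forall i, i \in e -> 0 <= w i,
        \sum_(i in e) w i = 1 &
        x = \sum_(i in e) w i *: p i].

Definition crosses (R : realType) (n : nat) (p : 'I_n -> 'rV[R]_2)
    (e f : {set 'I_n}) : Prop :=
  [disjoint e & f] /\
  exists x : 'rV[R]_2, in_conv_hull p e x /\ in_conv_hull p f x.

Definition noncrossing_edges (R : realType) (n : nat) (p : 'I_n -> 'rV[R]_2)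
    (T : {set {set 'I_n}}) : Prop :=
  (forall e, e \in T -> is_edge e) /\
  (forall e f, e \in T -> f \in T -> ~ crosses p e f).

Definition triangulation (R : realType) (n : nat) (p : 'I_n -> 'rV[R]_2)
    (T : {set {set 'I_n}}) : Prop :=
  noncrossing_edges p T /\
  forall T' : {set {set 'I_n}},
    noncrossing_edges p T' -> T \subset T' -> T' = T.

(* [(a, b)] is a clockwise oriented boundary edge; [ordS] is the successor
   modulo [n]. *)
Definition cw_boundary_edge (n : nat) (a b : 'I_n) : Prop := b = ordS a.

Definition interior_edge (n : nat) (e : {set 'I_n}) : Prop :=
  is_edge e /\
  forall a b : 'I_n, cw_boundary_edge a b -> e <> [set a; b].

(* The quadrilateral has vertices x, y, z, t in cyclic order, which is what the
   crossing of [set x; z] and [set y; t] (its two diagonals) expresses. *)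
Definition flip (R : realType) (n : nat) (p : 'I_n -> 'rV[R]_2)
    (T T' : {set {set 'I_n}}) : Prop :=
  exists x y z t : 'I_n,
    [/\ [set x; z] \in T /\ interior_edge [set x; z],
        is_edge [set y; t],
        crosses p [set x; z] [set y; t],
        [/\ [set x; y] \in T, [set y; z] \in T,
            [set z; t] \in T & [set t; x] \in T] &
        T' = [set y; t] |: (T :\ [set x; z])].

(* The path is the sequence U :: s of triangulations; its length, i.e. its
   number of flips, is [size s]. *)
Definition flip_path (R : realType) (n : nat) (p : 'I_n -> 'rV[R]_2)
    (U V : {set {set 'I_n}}) (s : seq {set {set 'I_n}}) : Prop :=
  [/\ forall T, T \in U :: s -> triangulation p T,
      path (fun T T' => `[< flip p T T' >]) U s &
      last U s = V].

Definition geodesic (R : realType) (n : nat) (p : 'I_n -> 'rV[R]_2)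
    (U V : {set {set 'I_n}}) (s : seq {set {set 'I_n}}) : Prop :=
  flip_path p U V s /\
  forall s', flip_path p U V s' -> (size s <= size s')%N.

(* In a triangulation T, and for a boundary edge {a, b}, exactly one vertex x
   satisfies the condition; the default value [a] is then irrelevant.  As all
   members of T have two elements, such an x differs from a and b. *)
Definition lk (n : nat) (T : {set {set 'I_n}}) (a b : 'I_n) : 'I_n :=
  odflt a [pick x | ([set a; x] \in T) && ([set b; x] \in T)].

Definition incident (n : nat) (a b : 'I_n) (T T' : {set {set 'I_n}}) : bool :=
  lk T a b != lk T' a b.

Definition nb_incident (n : nat) (a b : 'I_n)
    (U : {set {set 'I_n}}) (s : seq {set {set 'I_n}}) : nat :=
  count id (pairmap (incident a b) U s).

Definition is_max_incident (R : realType) (n : nat) (p : 'I_n -> 'rV[R]_2)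
    (U V : {set {set 'I_n}}) (a : 'I_n) (k : nat) : Prop :=
  (exists s, geodesic p U V s /\ nb_incident a (ordS a) U s = k) /\
  (forall s, geodesic p U V s -> (nb_incident a (ordS a) U s <= k)%N).

(* The maximum exists for triangulations U and V; the junk value would be 0. *)
Definition vartheta (R : realType) (n : nat) (p : 'I_n -> 'rV[R]_2)
    (U V : {set {set 'I_n}}) (a : 'I_n) : nat :=
  xget 0%N (is_max_incident p U V a).

(* Main.v *)
(* Along a path where the links of {a, b} and {c, d} each change at most once,
   every triangulation has its links equal to those in U or those in V.  If the
   link of {a, b} changes first, then {b, lk_V} appears while {c, lk_U} is still
   present, and these edges cross; the other order is symmetric.  If both links
   change in the same flip, the crossings force this flip to remove both
   {a, lk_U} and {c, lk_U}, which are distinct.  So every path from U to V has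
   two flips incident to {a, b} or two incident to {c, d}, and it remains to see
   that a geodesic exists, i.e. that the flip-graph is connected: any
   triangulation can be flipped to the fan at vertex 0, by flips increasing the
   degree of that vertex. *)

Require Import Defs.
From mathcomp Require Import all_boot all_order all_algebra.
From mathcomp Require Import boolp classical_sets reals.
From mathcomp Require Import zify ring lra.

Set Implicit Arguments.
Unset Strict Implicit.
Unset Printing Implicit Defensive.

Import Order.TTheory GRing.Theory Num.Theory.

(** * Interlacing of pairs of indices *)

Definition btw (i j k : nat) : bool := (i < k < j) || (j < k < i).

(** Combinatorial form of the crossing of two chords of a convex polygon: each separates the ends of
    the other. The exclusive or also forces [i] and [j], as well as [k] and [l], to differ, so that
    degenerate chords interlace nothing. *)
Definition interlaced (i j k l : nat) : bool :=
  [&& k != i, k != j, l != i, l != j &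
      (btw i j k && ~~ btw i j l) || (~~ btw i j k && btw i j l)].

Ltac nat_case := rewrite /interlaced /btw; lia.

Lemma interlaced_ltE i j k l : i < j -> k < l ->
  interlaced i j k l = (i < k < j) && (j < l) || (k < i < l) && (l < j).
Proof. by move=> ? ?; nat_case. Qed.

Lemma interlacedCl i j k l : interlaced i j k l = interlaced j i k l.
Proof. by nat_case. Qed.

Lemma interlacedCr i j k l : interlaced i j k l = interlaced i j l k.
Proof. by nat_case. Qed.

Lemma interlacedC i j k l : interlaced i j k l = interlaced k l i j.
Proof. by nat_case. Qed.

(** A chord through the diagonal [yt] has one end on each of the two arcs cut by [y] and [t]. An end
    other than [x] or [z] lies strictly inside an arc spanned by one side of the quadrilateral, and
    the chord then crosses that side. *)
Lemma quad_diagonal x y z t k l : interlaced x z y t -> interlaced y t k l ->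
  ~~ interlaced k l x y -> ~~ interlaced k l y z -> ~~ interlaced k l z t ->
  ~~ interlaced k l t x -> (k == x) && (l == z) || (k == z) && (l == x).
Proof.
have C1 i j u v : interlaced i j u v -> interlaced j i u v by rewrite interlacedCl.
have C2 i j u v : interlaced i j u v -> interlaced i j v u by rewrite interlacedCr.
have N1 i j u v : ~~ interlaced i j u v -> ~~ interlaced j i u v by rewrite interlacedCl.
have N2 i j u v : ~~ interlaced i j u v -> ~~ interlaced i j v u by rewrite interlacedCr.
(* Ordering the ends of all three chords makes [interlaced_ltE] applicable, which keeps the case
   analysis small. *)
wlog kl : k l / k < l => [hw|].
  case: (ltngtP k l) => [||->]; [exact: hw| |by nat_case].
  move=> kl h1 h2 h3 h4 h5 h6; rewrite orbC andbC [X in _ || X]andbC.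
  by apply: hw; auto.
wlog xz : x z / x < z => [hw|].
  case: (ltngtP x z) => [||->]; [exact: hw| |by nat_case].
  by move=> xz h1 h2 h3 h4 h5 h6; rewrite orbC; apply: hw; auto.
wlog yt : y t / y < t => [hw|].
  case: (ltngtP y t) => [||->]; [exact: hw| |by nat_case].
  by move=> yt h1 h2 h3 h4 h5 h6; apply: (hw t y); auto.
rewrite [interlaced k l t x]interlacedCr (@interlaced_ltE x z y t) // => /orP[] h.
  by rewrite !interlaced_ltE; lia.
rewrite [interlaced k l x y]interlacedCr [interlaced k l z t]interlacedCr.
by rewrite !interlaced_ltE; lia.
Qed.

(** * From geometric crossing to interlacing *)

Section Geometry.
Variables (R : realType) (n : nat) (p : 'I_n -> 'rV[R]_2).
Local Open Scope ring_scope.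

Lemma in_conv_hull2 (i j : 'I_n) (x : 'rV[R]_2) : i != j ->
  in_conv_hull p [set i; j]%SET x <->
  exists s t : R, [/\ 0 <= s, 0 <= t, s + t = 1 & x = s *: p i + t *: p j].
Proof.
move=> ij; split.
  case=> w []; rewrite !big_setU1 ?inE ?big_set1 //= => w0 w1 ->.
  exists (w i), (w j); split=> //; apply: w0; rewrite !inE eqxx ?orbT //.
case=> s [t [s0 t0 st ->]]; exists (fun k => if k == i then s else t).
rewrite !big_setU1 ?inE ?big_set1 //= eqxx eq_sym (negPf ij).
by split=> // k _; case: ifP.
Qed.

Lemma orient_comb (u v x y : 'rV[R]_2) (s t : R) : s + t = 1 ->
  orient u v (s *: x + t *: y) = s * orient u v x + t * orient u v y.
Proof.
move=> st; have -> : t = 1 - s by rewrite -st; ring.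
by rewrite /orient !mxE; ring.
Qed.

Lemma convex_comb_gt0 (s t x y : R) : 0 <= s -> 0 <= t -> s + t = 1 ->
  0 < x -> 0 < y -> 0 < s * x + t * y.
Proof.
move=> s0 t0 st x0 y0; case: (ltP 0 s) => [s1|s1].
  by rewrite ltr_wpDr // ?mulr_ge0 ?mulr_gt0 // ltW.
have t1 : t = 1 by lra.
by rewrite (_ : s = 0) ?mul0r ?add0r ?t1 ?mul1r //; lra.
Qed.

Lemma orient_cycle (u v w : 'rV[R]_2) : orient u v w = orient v w u.
Proof. by rewrite /orient; ring. Qed.

Lemma orient_swap (u v w : 'rV[R]_2) : orient u w v = - orient u v w.
Proof. by rewrite /orient; ring. Qed.

Lemma orient_id (u v : 'rV[R]_2) : orient u v u = 0 /\ orient u v v = 0.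
Proof. by rewrite /orient; split; ring. Qed.

Hypothesis Hp : convex_polygon p.

(** The line through two vertices separates the indices between theirs from the others. A swap or a
    cyclic shift reduces each case to an increasing triple. *)
Lemma orient_btw (i j k : 'I_n) : (i < j)%N -> k != i -> k != j ->
  if btw i j k then 0 < orient (p i) (p j) (p k)
  else orient (p i) (p j) (p k) < 0.
Proof.
case: Hp => _ cvx; rewrite -!val_eqE /= => ij ki kj.
case: ifP => [|h].
  move=> h; rewrite orient_swap oppr_gt0; apply: cvx; move: h; nat_case.
case: (ltnP k i) => ki'.
  rewrite -orient_cycle; apply: cvx; lia.
apply: cvx; move: h; nat_case.
Qed.

Lemma crosses_sym (e f : {set 'I_n}) : crosses p e f -> crosses p f e.
Proof. by case=> d [x [? ?]]; split; [rewrite disjoint_sym | exists x]. Qed.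

(** The orientation with respect to [p i] and [p j] vanishes at a common point of the two chords.
    Were [k] and [l] on the same side, it would keep a strict sign on the whole segment between
    them. *)
Lemma crosses_interlaced_lt (i j k l : 'I_n) : (i < j)%N -> k != l ->
  crosses p [set i; j]%SET [set k; l]%SET -> interlaced i j k l.
Proof.
move=> ij kl [dis [x [hij hkl]]].
have ij' : i != j by rewrite -val_eqE /=; lia.
have nin a : a \in [set k; l]%SET -> (a != i) /\ (a != j).
  by move=> ha; have := disjointFl dis ha; rewrite !inE => /negbT; rewrite negb_or => /andP[].
have [ki kj] : k != i /\ k != j by apply: nin; rewrite !inE eqxx.
have [li lj] : l != i /\ l != j by apply: nin; rewrite !inE eqxx orbT.
have := orient_btw ij ki kj; have := orient_btw ij li lj.
have x0 : orient (p i) (p j) x = 0.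
  have [s [t [_ _ st ->]]] := (in_conv_hull2 x ij').1 hij.
  by rewrite orient_comb //; have [-> ->] := orient_id (p i) (p j); rewrite !mulr0 addr0.
have [s [t [s0 t0 st xE]]] := (in_conv_hull2 x kl).1 hkl.
move: x0; rewrite xE orient_comb // => x0.
rewrite /interlaced -![_ != _ :> nat]/(_ != _ :> 'I_n) ki kj li lj /=.
case: ifP => _; case: ifP => _ //= h1 h2.
  by have := convex_comb_gt0 s0 t0 st h2 h1; rewrite x0 ltxx.
rewrite -oppr_gt0 in h1; rewrite -oppr_gt0 in h2.
by have := convex_comb_gt0 s0 t0 st h2 h1; rewrite !mulrN -opprD x0 oppr0 ltxx.
Qed.

Lemma crosses_of_lt (i k j l : 'I_n) : (i < k < j)%N -> (j < l)%N ->
  crosses p [set i; j]%SET [set k; l]%SET.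
Proof.
move=> ikj jl; have [ik kj] := andP ikj; case: Hp => _ cvx; split.
  rewrite disjoint_subset; apply/fintype.subsetP => a.
  by rewrite !inE -!val_eqE /=; lia.
(* The affine dependency of four points of the plane. *)
pose a0 := orient (p k) (p j) (p l); pose a1 := orient (p i) (p j) (p l).
pose a2 := orient (p i) (p k) (p l); pose a3 := orient (p i) (p k) (p j).
have h0 : a0 < 0 by apply: cvx; lia.
have h1 : a1 < 0 by apply: cvx; lia.
have h2 : a2 < 0 by apply: cvx; lia.
have h3 : a3 < 0 by apply: cvx; lia.
have sE : a0 + a2 = a1 + a3 by rewrite /a0 /a1 /a2 /a3 /orient; ring.
have vE : a0 *: p i + a2 *: p j = a1 *: p k + a3 *: p l.
  apply/rowP => c; rewrite !mxE /a0 /a1 /a2 /a3 /orient.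
  have /orP[/eqP ->|/eqP ->] : (c == 0) || (c == 1) by case: c => [[|[|]]].
    by ring.
  by ring.
have n0 : a0 + a2 != 0 by rewrite lt_eqF //; lra.
have dge0 (u : R) : u < 0 -> 0 <= u / (a0 + a2).
  by move=> u0; rewrite -mulrNN -invrN divr_ge0; lra.
(* All four coefficients are negative and both diagonals carry the same total weight by [sE].
   Dividing [vE] by this weight gives one point as a convex combination of either pair of ends. *)
exists ((a0 + a2)^-1 *: (a0 *: p i + a2 *: p j)); split.
  apply/in_conv_hull2; first by rewrite -val_eqE /=; lia.
  exists (a0 / (a0 + a2)), (a2 / (a0 + a2)); split; rewrite ?dge0 //.
    by rewrite -mulrDl divff.
  by rewrite scalerDr !scalerA ![_^-1 * _]mulrC.
apply/in_conv_hull2; first by rewrite -val_eqE /=; lia.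
exists (a1 / (a0 + a2)), (a3 / (a0 + a2)); split; rewrite ?dge0 //.
  by rewrite -mulrDl -sE divff.
by rewrite vE scalerDr !scalerA ![_^-1 * _]mulrC.
Qed.

(** This removes the plane from the argument: crossings become arithmetic on indices. *)
Lemma crossesE (i j k l : 'I_n) : i != j -> k != l ->
  crosses p [set i; j]%SET [set k; l]%SET <-> interlaced i j k l.
Proof.
wlog ij : i j / (i < j)%N => [hw|].
  case: (ltngtP i j) => [ij|ij|/val_inj ->]; last by rewrite eqxx.
    exact: hw.
  rewrite finset.setUC eq_sym => h1 h2; rewrite hw //; split; nat_case.
wlog kl : k l / (k < l)%N => [hw|].
  case: (ltngtP k l) => [kl|kl|/val_inj ->]; last by rewrite eqxx.
    exact: hw.
  rewrite [[set k; l]%SET]finset.setUC => h1; rewrite eq_sym => h2; rewrite hw //; split; nat_case.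
move=> ij' kl'; split; first exact: crosses_interlaced_lt.
case: (ltnP i k) => ik h; first by apply: crosses_of_lt; move: h; nat_case.
by apply: crosses_sym; apply: crosses_of_lt; move: h; nat_case.
Qed.

End Geometry.

(** * Triangulations as maximal sets of non-interlacing chords *)

Section Combinatorics.
Variable n : nat.
Implicit Types (T : {set {set 'I_n}}) (i j k l m o : 'I_n).
Local Notation "{ i , j }" := ([set i; j]%SET) (at level 0, i, j at level 99).

Lemma edgeC i j : {i, j} = {j, i}.
Proof. exact: finset.setUC. Qed.

Lemma is_edge2 i j : is_edge {i, j} = (i != j).
Proof. by rewrite /is_edge cards2; case: (i != j). Qed.

Lemma is_edgeP (e : {set 'I_n}) : is_edge e -> exists i j, i != j /\ e = {i, j}.
Proof. by move/cards2P. Qed.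

(** Maximality is tested one chord at a time. This amounts to maximality for inclusion, because a
    chord that crosses no member of [T] can be added to [T] alone. *)
Record comb_triangulation T : Prop := CombTriangulation {
  comb_edge : forall e, e \in T -> is_edge e;
  comb_noncrossing : forall i j k l,
    {i, j} \in T -> {k, l} \in T -> ~~ interlaced i j k l;
  comb_maximal : forall i j, i != j ->
    (forall k l, {k, l} \in T -> ~~ interlaced i j k l) -> {i, j} \in T }.

Lemma comb_neq T i j : comb_triangulation T -> {i, j} \in T -> i != j.
Proof. by move=> cT /(comb_edge cT); rewrite is_edge2. Qed.

Lemma triangulation_comb (R : realType) (p : 'I_n -> 'rV[R]_2) T :
  convex_polygon p -> triangulation p T <-> comb_triangulation T.
Proof.
move=> Hp; split.
  case=> -[Te Tnc] Tmax.
  have Tneq i j : {i, j} \in T -> i != j by move=> /Te; rewrite is_edge2.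
  have nc i j k l : {i, j} \in T -> {k, l} \in T -> ~~ interlaced i j k l.
    move=> ijT klT; apply/negP => h; apply: (Tnc _ _ ijT klT).
    by apply/crossesE; rewrite ?Tneq.
  split=> // i j ij hij.
  suff /Tmax <- : noncrossing_edges p ({i, j} |: T)%SET.
  - exact: setU11.
  - exact: finset.subsetUr.
  split=> [e|e f].
    by case/setU1P => [->|/Te //]; rewrite is_edge2.
  case/setU1P => [->|eT] /setU1P[->|fT].
  - by move=> /(crossesE Hp ij ij); apply/negP; nat_case.
  - have [k [l [kl fE]]] := is_edgeP (Te _ fT); rewrite fE in fT *.
    by move=> /(crossesE Hp ij kl); apply/negP/hij.
  - have [k [l [kl eE]]] := is_edgeP (Te _ eT); rewrite eE in eT *.
    by move=> /crosses_sym/(crossesE Hp ij kl); apply/negP/hij.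
  - exact: Tnc.
move=> cT; split; first split=> [|e f eT fT].
- exact: comb_edge.
- have [i [j [ij eE]]] := is_edgeP (comb_edge cT eT).
  have [k [l [kl fE]]] := is_edgeP (comb_edge cT fT); rewrite eE fE in eT fT *.
  by move=> /(crossesE Hp ij kl); apply/negP/(comb_noncrossing cT).
move=> T' [Te Tnc] sT; apply/eqP; rewrite finset.eqEsubset sT andbT.
apply/fintype.subsetP => e eT; have [i [j [ij eE]]] := is_edgeP (Te _ eT).
rewrite {}eE in eT *; apply: comb_maximal => // k l klT; apply/negP => h.
apply: (Tnc _ _ eT (fintype.subsetP sT _ klT)); apply/crossesE => //.
exact: comb_neq klT.
Qed.

(** * Triangles on either side of an edge, and links *)

Lemma boundary_in T i j : comb_triangulation T ->
  (j = i.+1 :> nat) \/ (0 < n.-1 /\ i = 0 :> nat /\ j = n.-1 :> nat) ->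
  {i, j} \in T.
Proof.
move=> cT ij; apply: comb_maximal => //; first by rewrite -val_eqE /=; lia.
(* No index lies strictly between [i] and [i.+1], and every index other than 0 and [n.-1] lies
   strictly between these two. *)
by move=> k l _; have := ltn_ord k; have := ltn_ord l; case: ij; nat_case.
Qed.

(** The apex is the largest neighbour [k] of [i] below [j]. A chord of [T] crossing [kj] but neither
    [ij] nor [ik] would start at [i] and end strictly between [k] and [j], against the choice of
    [k]. *)
Lemma inner_triangle T i j : comb_triangulation T -> {i, j} \in T ->
  i.+1 < j -> exists k, [/\ i < k < j, {i, k} \in T & {k, j} \in T].
Proof.
move=> cT ijT ij; have i1n : i.+1 < n by have := ltn_ord j; lia.
pose P k := (i < k < j) && ({i, k} \in T).
have P1 : P (Ordinal i1n) by rewrite /P /= leqnn ij boundary_in //; left.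
case: (@arg_maxnP _ _ P (@nat_of_ord n) P1) => k /andP[ikj ikT] kmax.
exists k; split=> //; apply: comb_maximal => //; first by rewrite -val_eqE /=; lia.
move=> u v uvT; apply/negP => h.
have hi := comb_noncrossing cT uvT ijT; have hk := comb_noncrossing cT uvT ikT.
have [uE|vE] : (u = i /\ k < v < j) \/ (v = i /\ k < u < j).
  have : (u = i :> nat /\ k < v < j) \/ (v = i :> nat /\ k < u < j).
    by move: h hi hk; nat_case.
  by case=> -[/val_inj ? ?]; [left|right].
- case: uE => uE kv; rewrite uE in uvT; have := kmax v; rewrite /P uvT /=; lia.
- case: vE => vE ku; rewrite vE edgeC in uvT; have := kmax u; rewrite /P uvT /=; lia.
Qed.

(** Among the other chords of [T] that span [ij], take a shortest one, [uv]. The apex [k] of its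
    inner triangle is not strictly between [i] and [j], so [uk] or [kv] spans [ij]; by minimality it
    is [ij]. *)
Lemma outer_triangle T i j : comb_triangulation T -> {i, j} \in T ->
  i < j -> (i != 0 :> nat) || (j != n.-1 :> nat) ->
  exists k, [/\ k < i \/ j < k, {i, k} \in T & {j, k} \in T].
Proof.
move=> cT ijT ij nij; have n0 : 0 < n by have := ltn_ord i; lia.
have lt1 : n.-1 < n by lia.
pose P (e : 'I_n * 'I_n) :=
  [&& e.1 <= i, j <= e.2, e != (i, j) & {e.1, e.2} \in T].
(* The side joining the first and last vertices is a candidate, since [ij] is assumed to differ from
   it. *)
have P0 : P (Ordinal n0, Ordinal lt1).
  apply/and4P; split=> //=.
  - by have := ltn_ord j; lia.
  - by rewrite xpair_eqE -!val_eqE /=; lia.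
  - by apply: boundary_in => //; right; have := ltn_ord j; rewrite /=; lia.
case: (@arg_minnP _ _ P (fun e => e.2 - e.1) P0) => -[u v] /and4P[/= ui jv uv uvT] umin.
have {}uv : (u < i) || (j < v) by move: uv; rewrite xpair_eqE -!val_eqE /=; lia.
have [|k [ukv ukT kvT]] := inner_triangle cT uvT; first by lia.
have huk := comb_noncrossing cT ijT ukT; have hkv := comb_noncrossing cT ijT kvT.
have [ki|jk] : k <= i \/ j <= k by move: huk hkv; nat_case.
  case: (eqVneq (k, v) (i, j)) => [[kE vE]|ne].
    by exists u; rewrite kE vE in ukT uvT ukv; split; [left; lia | rewrite edgeC..].
  by have := umin (k, v); rewrite /P /= ki jv ne kvT => /(_ isT); lia.
case: (eqVneq (u, k) (i, j)) => [[uE kE]|ne].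
  by exists v; rewrite kE uE in kvT uvT ukv; split=> //; right; lia.
by have := umin (u, k); rewrite /P /= ui jk ne ukT => /(_ isT); lia.
Qed.

(** A triangle of [T] on the boundary edge provides a common neighbour, so [lk] never takes its
    default value. *)
Lemma lk_in T i : 2 < n -> comb_triangulation T ->
  {i, lk T i (ordS i)} \in T /\ {ordS i, lk T i (ordS i)} \in T.
Proof.
move=> n2 cT; rewrite /lk; case: pickP => [x /andP[]//|/= no].
suff [k ik jk] : exists2 k, {i, k} \in T & {ordS i, k} \in T.
  by have := no k; rewrite ik jk.
(* The side from the last vertex back to vertex 0 spans all indices, so its triangle is an inner
   one; for any other side it is an outer one. *)
case: (eqVneq i.+1 n) => [iE|ne].
  have s0 : ordS i = 0 :> nat by rewrite /= iE modnn.
  have oT : {ordS i, i} \in T by apply: boundary_in => //; right; lia.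
  have [|k [_ h1 h2]] := inner_triangle cT oT; first by lia.
  by exists k => //; rewrite edgeC.
have sE : ordS i = i.+1 :> nat by rewrite /= modn_small //; have := ltn_ord i; lia.
have oT : {i, ordS i} \in T by apply: boundary_in => //; left.
by have [||k [_ h1 h2]] := outer_triangle cT oT; [lia..|exists k].
Qed.

(** * Flips on indices, and the fan at vertex 0 *)

Lemma edge_eq i j k l :
  {i, j} = {k, l} -> i = k /\ j = l \/ i = l /\ j = k.
Proof.
move=> e; have := set21 i j; have := set22 i j; have := set21 k l; have := set22 k l.
rewrite e -{1 2}e !inE.
by do 4![case/orP => /eqP ?]; subst; auto.
Qed.

Lemma edge_eqE i j k l : ({i, j} == {k, l}) =
  ((i == k :> nat) && (j == l :> nat)) || ((i == l :> nat) && (j == k :> nat)).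
Proof.
apply/eqP/idP => [/edge_eq[[-> ->]|[-> ->]]|]; rewrite ?eqxx ?orbT //.
by case/orP => /andP[/eqP/val_inj -> /eqP/val_inj ->] //; rewrite edgeC.
Qed.

(** The crossing of the diagonals is read on indices; that [xz] is an interior edge follows from it,
    as [flip_of_comb_flip] shows. *)
Definition comb_flip T T' : Prop := exists x y z t : 'I_n,
  [/\ {x, z} \in T, interlaced x z y t,
      [/\ {x, y} \in T, {y, z} \in T, {z, t} \in T & {t, x} \in T] &
      T' = ({y, t} |: (T :\ {x, z}))%SET].

(** By [quad_diagonal], [xz] is the only chord of [T] crossing [yt], so the new set has no crossing.
    For maximality, a chord compatible with the new set either crosses [xz], and is [yt] by the same
    lemma with the diagonals exchanged, or is compatible with [T]. *)
Lemma comb_flip_triangulation T T' :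
  comb_triangulation T -> comb_flip T T' -> comb_triangulation T'.
Proof.
move=> cT [x [y [z [t [xzT xzyt [xyT yzT ztT txT] ->]]]]].
have cross_yt k l : {k, l} \in T -> {k, l} != {x, z} -> ~~ interlaced y t k l.
  move=> klT; rewrite edge_eqE; apply: contra => ytkl.
  by apply: quad_diagonal xzyt ytkl _ _ _ _; apply: (comb_noncrossing cT).
split.
- move=> e /setU1P[->|/setD1P[_ /(comb_edge cT)//]].
  by rewrite is_edge2 -val_eqE /=; move: xzyt; nat_case.
- move=> i j k l; rewrite !in_setU1 !in_setD1.
  case/orP => [ijE|/andP[ij ijT]] /orP[klE|/andP[kl klT]].
  + by move: ijE klE; rewrite !edge_eqE; nat_case.
  + by move: ijE (cross_yt _ _ klT kl); rewrite !edge_eqE; nat_case.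
  + by move: klE (cross_yt _ _ ijT ij); rewrite !edge_eqE; nat_case.
  + exact: (comb_noncrossing cT).
- move=> i j ij hij; rewrite in_setU1 in_setD1.
  have hyt : ~~ interlaced i j y t by apply: hij; rewrite setU11.
  have sub k l : {k, l} \in T -> {k, l} != {x, z} -> ~~ interlaced i j k l.
    by move=> klT kl; apply: hij; rewrite in_setU1 in_setD1 kl klT orbT.
  case: (boolP (interlaced i j x z)) => ijxz.
    apply/orP; left; rewrite edge_eqE.
    have h1 : interlaced y t z x by rewrite interlacedC interlacedCl.
    have h2 : interlaced z x i j by rewrite interlacedCl interlacedC.
    apply: quad_diagonal h1 h2 _ _ _ _; apply: sub => //;
      rewrite edge_eqE; move: xzyt; nat_case.
  apply/orP; right; apply/andP; split.
    by rewrite edge_eqE; move: xzyt hyt; nat_case.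
  apply: comb_maximal => // k l klT.
  case: (boolP ({k, l} == {x, z})) => [|kl]; last exact: sub.
  by rewrite edge_eqE; move: ijxz; nat_case.
Qed.

Lemma comb_flip_sym T T' :
  comb_triangulation T -> comb_flip T T' -> comb_flip T' T.
Proof.
move=> cT [x [y [z [t [xzT xzyt [xyT yzT ztT txT] ->]]]]].
(* Rotating the quadrilateral by one vertex exchanges its diagonals. *)
exists y, z, t, x; split.
- exact: setU11.
- by move: xzyt; nat_case.
- split; rewrite in_setU1 in_setD1 edge_eqE.
  + by rewrite yzT andbT; apply/orP; right; rewrite edge_eqE; move: xzyt; nat_case.
  + by rewrite ztT andbT; apply/orP; right; rewrite edge_eqE; move: xzyt; nat_case.
  + by rewrite txT andbT; apply/orP; right; rewrite edge_eqE; move: xzyt; nat_case.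
  + by rewrite xyT andbT; apply/orP; right; rewrite edge_eqE; move: xzyt; nat_case.
- have ytT : {y, t} \notin T.
    by apply/negP => /(comb_noncrossing cT xzT); rewrite xzyt.
  rewrite setU1K ?inE ?negb_and ?ytT ?orbT //.
  by rewrite [{z, x}]edgeC finset.setD1K.
Qed.

Lemma boundary_not_interlaced i k l : ~~ interlaced i (ordS i) k l.
Proof.
have := ltn_ord i; have := ltn_ord k; have := ltn_ord l.
case: (eqVneq i.+1 n) => [iE|ne].
  by have -> : ordS i = 0 :> nat; [rewrite /= iE modnn | nat_case].
move=> ? ? ?; have -> : ordS i = i.+1 :> nat by rewrite /= modn_small //; lia.
by nat_case.
Qed.

Lemma flip_of_comb_flip (R : realType) (p : 'I_n -> 'rV[R]_2) T T' :
  convex_polygon p -> comb_flip T T' -> flip p T T'.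
Proof.
move=> Hp [x [y [z [t [xzT xzyt sides ->]]]]].
have xz : x != z by rewrite -val_eqE /=; move: xzyt; nat_case.
have yt : y != t by rewrite -val_eqE /=; move: xzyt; nat_case.
exists x, y, z, t; split=> //; last by apply/crossesE.
- split=> //; split; first by rewrite is_edge2.
  move=> a b -> /eqP; rewrite edge_eqE => e.
  by have := boundary_not_interlaced a y t; move: e xzyt; nat_case.
- by rewrite is_edge2.
Qed.

(* Contains [o] itself, as triangulations have no singletons. *)
Definition non_neighbors T o := [set k | {o, k} \notin T]%SET.

(** The vertex [m] lies in a gap between two consecutive neighbours [i] and [j] of [o]. Then [ij] is
    in [T], with [o] on one side and the apex [k] of its inner triangle on the other. Flipping [ij]
    joins [o] to [k] and removes no edge at [o]. *)
Lemma flip_toward_fan T o m : comb_triangulation T -> o = 0 :> nat ->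
  m != o -> {o, m} \notin T ->
  exists T', comb_flip T T' /\ #|non_neighbors T' o| < #|non_neighbors T o|.
Proof.
move=> cT o0 mo omT.
have mo' : 0 < m by move: mo; rewrite -val_eqE /=; lia.
have mn := ltn_ord m; have n1 : 1 < n by lia.
have ln : n.-1 < n by lia.
pose P k := (0 < k < m) && ({o, k} \in T); pose Q k := (m < k) && ({o, k} \in T).
have o1 : {o, Ordinal n1} \in T by apply: boundary_in => //; left; rewrite o0.
have on : {o, Ordinal ln} \in T by apply: boundary_in => //; right; rewrite o0 /=; lia.
have P1 : P (Ordinal n1).
  rewrite /P o1 andbT /=; suff : m != 1 :> nat by lia.
  by apply: contraNneq omT => m1; rewrite (_ : m = Ordinal n1) //; apply: val_inj.
have Q1 : Q (Ordinal ln).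
  rewrite /Q on andbT /=; suff : m != n.-1 :> nat by lia.
  by apply: contraNneq omT => m1; rewrite (_ : m = Ordinal ln) //; apply: val_inj.
case: (@arg_maxnP _ _ P (@nat_of_ord n) P1) => i /andP[im oiT] imax.
case: (@arg_minnP _ _ Q (@nat_of_ord n) Q1) => j /andP[mj ojT] jmin.
have nbr k : i < k < j -> {o, k} \notin T.
  move=> ikj; apply/negP => okT.
  case: (ltngtP k m) => [km|km|/val_inj km].
  - by have := imax k; rewrite /P okT andbT /=; lia.
  - by have := jmin k; rewrite /Q okT andbT /=; lia.
  - by move: omT; rewrite -km okT.
have ijT : {i, j} \in T.
  apply: comb_maximal => //; first by rewrite -val_eqE /=; lia.
  move=> u v uvT; apply/negP => h.
  have hi := comb_noncrossing cT uvT oiT; have hj := comb_noncrossing cT uvT ojT.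
  (* A chord crossing [ij] but neither [oi] nor [oj] must leave from [o] into the gap, where [o] has
     no neighbour. *)
  have : (u = o :> nat /\ i < v < j) \/ (v = o :> nat /\ i < u < j).
    by move: h hi hj; rewrite o0; nat_case.
  case=> -[/val_inj e /nbr]; first by rewrite -e uvT.
  by rewrite -e edgeC uvT.
have [|k [ikj ikT kjT]] := inner_triangle cT ijT; first by lia.
exists ({o, k} |: (T :\ {i, j}))%SET; split.
  exists i, o, j, k; split=> //; first by rewrite interlacedC interlaced_ltE ?o0; clear -im ikj; lia.
  by split=> //; rewrite edgeC.
apply: proper_card; apply/properP; split.
  apply/fintype.subsetP => l; rewrite !inE edge_eqE; apply: contraNN => olT.
  by rewrite olT andbT edge_eqE o0; apply/orP; right; lia.
by exists k; rewrite !inE ?eqxx // nbr.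
Qed.

(** If a chord of one fan avoids [o], no index lies strictly between its ends: the edge from [o] to
    such an index would cross it. Hence nothing interlaces this chord, and maximality puts it in the
    other fan. *)
Lemma fan_unique T T' o : comb_triangulation T -> comb_triangulation T' ->
  o = 0 :> nat -> (forall k, k != o -> {o, k} \in T) ->
  (forall k, k != o -> {o, k} \in T') -> T = T'.
Proof.
suff sub S S' : comb_triangulation S -> comb_triangulation S' ->
    o = 0 :> nat -> (forall k, k != o -> {o, k} \in S) ->
    (forall k, k != o -> {o, k} \in S') -> S \subset S'.
  by move=> *; apply/eqP; rewrite finset.eqEsubset !sub.
move=> cS cS' o0 fS fS'; apply/fintype.subsetP => e eS.
have [i [j [ij eE]]] := is_edgeP (comb_edge cS eS); rewrite {}eE in eS *.
case: (eqVneq i o) => [iE|io]; first by rewrite iE in ij *; apply: fS'; rewrite eq_sym.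
case: (eqVneq j o) => [jE|jo]; first by rewrite jE in ij *; rewrite edgeC; apply: fS'.
apply: comb_maximal => // k l klS'; apply/negP => h.
have crossed m : btw i j m -> False.
  move=> ijm; have mo : m != o.
    by rewrite -val_eqE /=; move: ijm; rewrite o0; nat_case.
  have := comb_noncrossing cS eS (fS m mo); move: ijm io jo.
  by rewrite -!val_eqE /= o0; nat_case.
by case: (boolP (btw i j k)) => [/crossed//|hk]; apply: (crossed l); move: h hk; nat_case.
Qed.

End Combinatorics.

(** * Connectivity of the flip-graph and existence of geodesics *)

Section Connectivity.
Variables (R : realType) (n : nat) (p : 'I_n -> 'rV[R]_2).
Hypothesis Hp : convex_polygon p.
Implicit Types (T U V : {set {set 'I_n}}) (s : seq {set {set 'I_n}}).

(** Requiring the source to be a triangulation makes the relation symmetric on all sets of edges, so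
    that paths to the fan can be reversed. *)
Definition flip_rel : rel {set {set 'I_n}} := fun T T' =>
  `[< comb_triangulation T /\ comb_flip T T' >].

Lemma flip_rel_sym : symmetric flip_rel.
Proof.
suff flipC T T' : flip_rel T T' -> flip_rel T' T by move=> T T'; apply/idP/idP; apply: flipC.
move=> /asboolP[cT TT']; apply/asboolP; split.
  exact: comb_flip_triangulation TT'.
exact: comb_flip_sym.
Qed.

Lemma connect_fan T (o : 'I_n) : o = 0 :> nat -> comb_triangulation T ->
  exists F, [/\ connect flip_rel T F, comb_triangulation F &
                forall k, k != o -> [set o; k]%SET \in F].
Proof.
move=> o0; move: {2}_.+1 (ltnSn #|non_neighbors T o|) => m.
elim: m T => // m IH T Tm cT.
case: (pselect (exists k, k != o /\ [set o; k]%SET \notin T)) => [|full].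
  case=> k [ko okT].
  have [T' [TT' lt]] := flip_toward_fan cT o0 ko okT.
  have [||F [T'F cF fF]] := IH T'; first exact: leq_trans lt _.
    exact: comb_flip_triangulation TT'.
  exists F; split=> //; apply: connect_trans T'F; apply: connect1.
  exact/asboolP.
exists T; split=> // k ko; apply/negPn/negP => okT; apply: full; by exists k.
Qed.

Lemma flip_connected U V : triangulation p U -> triangulation p V ->
  exists s, flip_path p U V s.
Proof.
move=> /(triangulation_comb _ Hp) cU /(triangulation_comb _ Hp) cV.
have n0 : 0 < n by case: Hp => n2 _; apply: leq_trans n2.
have [F [UF cF fF]] := connect_fan (erefl : Ordinal n0 = 0 :> nat) cU.
have [F' [VF cF' fF']] := connect_fan (erefl : Ordinal n0 = 0 :> nat) cV.
have FF' : F = F' by apply: fan_unique fF fF'.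
have : connect flip_rel U V.
  by apply: connect_trans UF _; rewrite FF' (sym_connect_sym flip_rel_sym).
case/connectP => s Us ->; exists s; split=> //.
  elim: s U cU Us {UF} => [|T' s IH] U cU /=.
    by move=> _ T; rewrite inE => /eqP ->; apply/triangulation_comb.
  case/andP => /asboolP[_ UT'] T's T; rewrite inE => /orP[/eqP ->|].
    exact/triangulation_comb.
  by apply: IH T's _; apply: comb_flip_triangulation UT'.
apply: sub_path Us => T T' /asboolP[_ TT']; apply/asboolP.
exact: flip_of_comb_flip.
Qed.

Lemma geodesic_exists U V : triangulation p U -> triangulation p V ->
  exists s, geodesic p U V s.
Proof.
move=> tU tV; pose P k := `[< exists s, flip_path p U V s /\ size s = k >].
have exP : exists k, P k.
  by have [s Us] := flip_connected tU tV; exists (size s); apply/asboolP; exists s.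
case: (ex_minnP exP) => k /asboolP[s [Us <-]] kmin; exists s; split=> // s' Us'.
by apply: kmin; apply/asboolP; exists s'.
Qed.

(** No geodesic is longer than [s], and its incident flips are at most as many as its flips. The
    maximum therefore exists, and [vartheta] is not the default value of [xget]. *)
Lemma nb_incident_vartheta U V (a : 'I_n) s : geodesic p U V s ->
  nb_incident a (ordS a) U s <= vartheta p U V a.
Proof.
move=> gs.
pose P k := `[< exists s, geodesic p U V s /\ nb_incident a (ordS a) U s = k >].
have exP : exists k, P k by exists (nb_incident a (ordS a) U s); apply/asboolP; exists s.
have bdP k : P k -> k <= size s.
  case/asboolP => s' [[Us' min'] <-]; case: gs => Us _.
  by apply: leq_trans (min' _ Us); rewrite -(size_pairmap (incident a (ordS a)) U s') count_size.
case: (ex_maxnP exP bdP) => k /asboolP kP kmax.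
suff : is_max_incident p U V a (vartheta p U V a) by case=> _; apply.
apply: xgetPex; exists k; split=> // s' gs'.
by apply: kmax; apply/asboolP; exists s'.
Qed.

End Connectivity.

(** * Flips incident to two boundary edges along a path *)

Section Incidence.
Variable n : nat.
Implicit Types (T U V : {set {set 'I_n}}) (s : seq {set {set 'I_n}}) (a b : 'I_n).

Lemma nb_incident_cons a b T T' s :
  nb_incident a b T (T' :: s) = incident a b T T' + nb_incident a b T' s.
Proof. by []. Qed.

Lemma lk_last_not_incident a b T s :
  nb_incident a b T s = 0 -> lk (last T s) a b = lk T a b.
Proof.
elim: s T => //= T' s IH T; rewrite nb_incident_cons.
move=> /eqP; rewrite addn_eq0 eqb0 negbK => /andP[/eqP -> /eqP /IH].
by [].
Qed.

Lemma removed_edge (R : realType) (p : 'I_n -> 'rV[R]_2) T T'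
    (e f : {set 'I_n}) :
  flip p T T' -> e \in T -> f \in T -> e \notin T' -> f \notin T' -> e = f.
Proof.
case=> x [y [z [t [_ _ _ _ ->]]]] eT fT.
by rewrite !inE eT fT !andbT !negb_or !negbK => /andP[_ /eqP ->] /andP[_ /eqP ->].
Qed.

Lemma incident_twice (R : realType) (p : 'I_n -> 'rV[R]_2) T V s (a c : 'I_n)
    (b := ordS a) (d := ordS c) :
  convex_polygon p -> flip_path p T V s ->
  [set a; lk T a b]%SET <> [set c; lk T c d]%SET ->
  crosses p [set a; lk T a b]%SET [set d; lk V c d]%SET ->
  crosses p [set c; lk T c d]%SET [set b; lk V a b]%SET ->
  (1 < nb_incident a b T s) || (1 < nb_incident c d T s).
Proof.
move=> Hp [triT pT VE] neq crA crC.
have lkT T' i : triangulation p T' ->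
    [set i; lk T' i (ordS i)]%SET \in T' /\ [set ordS i; lk T' i (ordS i)]%SET \in T'.
  by move=> /(triangulation_comb _ Hp); apply: lk_in; case: Hp.
have nc T' e f : triangulation p T' -> crosses p e f -> e \in T' -> f \notin T'.
  by move=> [[_ h] _] ef eT; apply/negP => fT; exact: h ef.
rewrite -[_ || _]negbK negb_or -!leqNgt; apply/negP => /andP[].
(* The initial triangulation is generalized so that the induction can skip the flips that change
   neither link. *)
elim: s T triT pT VE neq crA crC => [|T' s IH] T triT.
  (* On an empty path, the two edges that cross would belong to the same triangulation. *)
  move=> _ <- _ crA _ _ _; have tT : triangulation p T by apply: triT; rewrite inE.
  by have /negP := nc _ _ _ tT crA (lkT _ a tT).1; apply; exact: (lkT _ c tT).2.
rewrite !nb_incident_cons /= => /andP[/asboolP TT' pT'] VE neq crA crC.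
have tT : triangulation p T by apply: triT; rewrite inE eqxx.
have tT' : triangulation p T' by apply: triT; rewrite !inE eqxx orbT.
have [[aT _] [cT _]] := (lkT _ a tT, lkT _ c tT).
have [[aT' bT'] [cT' dT']] := (lkT _ a tT', lkT _ c tT').
have lkV i : nb_incident i (ordS i) T' s = 0 -> lk V i (ordS i) = lk T' i (ordS i).
  by rewrite -VE; apply: lk_last_not_incident.
case: (boolP (incident a b T T')) => iA; case: (boolP (incident c d T T')) => iC.
(* Both links already have their final values in [T'], so each old edge crosses an edge of [T']: a
   single flip would remove both. *)
- rewrite !add1n !ltnS !leqn0 => /eqP nA /eqP nC; apply: neq.
  rewrite (lkV c nC) in crA; rewrite (lkV a nA) in crC.
  apply: (removed_edge TT') => //.
    exact: (nc _ _ _ tT' (crosses_sym crA)).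
  exact: (nc _ _ _ tT' (crosses_sym crC)).
(* Here [T'] contains both the final edge at [b] and the unchanged edge at [c], which cross. *)
- rewrite add1n ltnS leqn0 => /eqP nA _.
  rewrite (lkV a nA) in crC; move/negPn/eqP: iC => iC; rewrite iC in crC.
  by have /negP := nc _ _ _ tT' crC cT'; apply.
- move=> _; rewrite add1n ltnS leqn0 => /eqP nC.
  rewrite (lkV c nC) in crA; move/negPn/eqP: iA => iA; rewrite iA in crA.
  by have /negP := nc _ _ _ tT' crA aT'; apply.
- move/negPn/eqP: iA => iA; move/negPn/eqP: iC => iC; rewrite iA iC in neq crA crC.
  by apply: IH => // T'' h; apply: triT; rewrite inE h orbT.
Qed.

End Incidence.

Theorem theorem4 (R : realType) (n : nat) (p : 'I_n -> 'rV[R]_2)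
    (Hp : convex_polygon p)
    (U V : {set {set 'I_n}})
    (HU : triangulation p U) (HV : triangulation p V)
    (a b c d : 'I_n)
    (Hab : cw_boundary_edge a b) (Hcd : cw_boundary_edge c d)
    (Hneq : [set a; lk U a b]%SET <> [set c; lk U c d]%SET)
    (Hcross_a : crosses p [set a; lk U a b]%SET [set d; lk V c d]%SET)
    (Hcross_c : crosses p [set c; lk U c d]%SET [set b; lk V a b]%SET) :
  ~ ((vartheta p U V a < 2)%N /\ (vartheta p U V c < 2)%N).
Proof.
move: Hneq Hcross_a Hcross_c; rewrite Hab Hcd => neq crA crC [thA thC].
(* One geodesic is enough, as its two counts bound the two maxima from below. *)
have [s gs] := geodesic_exists Hp HU HV; have [Us _] := gs.
have := incident_twice Hp Us neq crA crC.
have := nb_incident_vartheta a gs; have := nb_incident_vartheta c gs.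
by lia.
Qed.
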